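(* For every integer $n\ge 3$, every sun graph $S_n$ satisfies $$\alpha(S_n)+\alpha(L(S_n))=2n \quad\text{and}\quad \alpha(S_n)\cdot\alpha(L(S_n))=n^2 .$$
   Context: For $n\ge 3$, an $n$-sun (or trampoline), denoted $S_n$, is a chordal graph on $2n$ vertices whose vertex set can be partitioned into two sets $U=\{u_1,\ldots,u_n\}$ and $W=\{w_1,\ldots,w_n\}$ such that $U$ is an independent set and $u_i$ is adjacent to $w_j$ if and only if $j=i$ or $j\equiv i+1 \pmod n$. For a graph $G$, $\alpha(G)$ denotes its independence number, i.e. the maximum cardinality of a set of pairwise non-adjacent vertices of $G$. $L(G)$ denotes the line graph of $G$: its vertices are in one-to-one correspondence with the edges of $G$, and two vertices of $L(G)$ are adjacent if and only if the corresponding edges of $G$ are adjacent (share an endpoint). *)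

(* Defs.v *)
From HB Require Import structures.
From mathcomp Require Import all_boot.

Set Implicit Arguments.
Unset Strict Implicit.
Unset Printing Implicit Defensive.

Record sgraph := SGraph {
  vertex :> finType;
  adj : rel vertex;
  adj_sym : symmetric adj;
  adj_irr : irreflexive adj
}.

Arguments adj {G} : rename.

Definition independent (G : sgraph) (S : {set G}) : bool :=
  [forall x in S, forall y in S, ~~ adj x y].

Definition alpha (G : sgraph) : nat :=
  \max_(S : {set G} | independent S) #|S|.

Definition chordal (G : sgraph) : Prop :=
  forall c : seq G, ucycle adj c -> 4 <= size c ->
  exists x y : G,
    [/\ x \in c, y \in c, adj x y, y != next c x & x != next c y].

Definition edges (G : sgraph) : {set {set G}} :=
  [set [set p.1; p.2] | p in [set p : G * G | adj p.1 p.2]].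

Definition edge (G : sgraph) : finType := {A : {set G} | A \in edges G}.

Definition ladj (G : sgraph) : rel (edge G) :=
  fun A B => (A != B) && (val A :&: val B != set0).

Lemma ladj_sym (G : sgraph) : symmetric (@ladj G).
Proof. by move=> A B; rewrite /ladj eq_sym setIC. Qed.

Lemma ladj_irr (G : sgraph) : irreflexive (@ladj G).
Proof. by move=> A; rewrite /ladj eqxx. Qed.

Definition line_graph (G : sgraph) : sgraph :=
  SGraph (@ladj_sym G) (@ladj_irr G).

(* Indices run over 0, ..., n-1 instead of 1, ..., n. *)
Definition is_sun (n : nat) (G : sgraph) : Prop :=
  [/\ chordal G, #|G| = 2 * n &
   exists u w : 'I_n -> G,
     let U := [set u i | i : 'I_n] in
     let W := [set w i | i : 'I_n] in
     [/\ injective u /\ injective w,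
         U :|: W = [set: G] /\ [disjoint U & W],
         independent U &
         forall i j : 'I_n,
           adj (u i) (w j) = (j == i) || (j == i + 1 %[mod n])]].

(* Main.v *)
Require Import Defs.
From mathcomp Require Import all_boot.

(** The edges [u_i w_i] form a perfect matching of [S_n].  An independent set
    meets each of them at most once, and [U] attains the resulting bound [n];
    a matching has at most half as many edges as there are vertices, and this
    perfect matching attains that bound, again [n].  So both independence
    numbers equal [n]. *)

Lemma leq_alpha (G : sgraph) (S : {set G}) : independent S -> #|S| <= alpha G.
Proof. by move=> indS; apply: (leq_bigmax_cond (F := fun S => #|pred_of_set S|)). Qed.

Lemma independentP (G : sgraph) (S : {set G}) :
  reflect {in S &, forall x y, ~~ adj x y} (independent S).
Proof.
apply: (iffP forall_inP) => [indS x y Sx Sy | indS x Sx].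
  by have /forall_inP := indS x Sx; apply.
by apply/forall_inP => y; apply: indS.
Qed.

Lemma edge_card (G : sgraph) (A : {set G}) : A \in edges G -> #|A| = 2.
Proof.
case/imsetP=> -[x y]; rewrite inE /= => xy ->; rewrite cards2.
by case: eqVneq xy => // ->; rewrite adj_irr.
Qed.

Lemma mem_edges (G : sgraph) (x y : G) : adj x y -> [set x; y] \in edges G.
Proof. by move=> xy; apply/imsetP; exists (x, y); rewrite ?inE. Qed.

(** An independent set of [line_graph G] is a matching: its members are pairwise disjoint 2-sets, so
    their union has twice as many vertices as there are members. *)
Lemma alpha_line_graph_leq (G : sgraph) : alpha (line_graph G) <= #|G|./2.
Proof.
apply/bigmax_leqP => M /independentP indM; rewrite geq_half_double -mul2n.
pose P := [set val A | A : edge G in M].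
have trivP : trivIset P.
  apply/trivIsetP => _ _ /imsetP[A MA ->] /imsetP[B MB ->] neqAB.
  (* Non-adjacency in the line graph means equal or disjoint; distinct underlying sets exclude
     equality. *)
  have := indM A B MA MB; rewrite /= /ladj negb_and.
  have -> : A != B by apply: contraNneq neqAB => ->.
  by rewrite /= negbK setI_eq0.
have <- : \sum_(B in P) #|B| = 2 * #|M|.
  rewrite big_imset /=; last by move=> A B _ _; apply: val_inj.
  by rewrite (eq_bigr (fun=> 2)) ?sum_nat_const 1?mulnC // => A _; apply/edge_card/valP.
by rewrite (eqP trivP) max_card.
Qed.

Section Matching.

Variables (G : sgraph) (T : finType) (u w : T -> G).
Hypothesis adj_uw : forall i, adj (u i) (w i).

Lemma alpha_leq_matching :
  [set u i | i : T] :|: [set w i | i : T] = setT -> alpha G <= #|T|.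
Proof.
move=> coverG; apply/bigmax_leqP => S /independentP indS.
(* Counting moves from vertices to indices: [A] and [B] are disjoint subsets of [T] whose images
   cover [S], so [#|S| <= #|A| + #|B| <= #|T|]. *)
pose A := u @^-1: S; pose B := w @^-1: S.
have disjAB : A :&: B = set0.
  apply/setP => i; rewrite !inE; apply/negP => /andP[Su Sw].
  by have := indS _ _ Su Sw; rewrite adj_uw.
have subS : S \subset u @: A :|: w @: B.
  apply/subsetP => x Sx; have: x \in setT by [].
  rewrite -coverG => /setUP[] /imsetP[i _ def_x]; apply/setUP; [left | right];
    by rewrite def_x imset_f // inE -def_x.
apply: leq_trans (subset_leq_card subS) _; rewrite cardsU.
apply: leq_trans (leq_subr _ _) _.
apply: leq_trans (leq_add (leq_imset_card _ _) (leq_imset_card _ _)) _.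
by rewrite -cardsUI disjAB cards0 addn0 max_card.
Qed.

(** The edges [[set u i; w i]] are pairwise disjoint, hence form an independent set of the line
    graph indexed by [T]. *)
Lemma leq_alpha_line_graph_matching :
    injective u -> injective w ->
    [disjoint [set u i | i : T] & [set w i | i : T]] ->
  #|T| <= alpha (line_graph G).
Proof.
move=> inj_u inj_w disjUW.
have neq_uw i j : u i != w j.
  apply/eqP => eq_uw; have: u i \in [set u i | i : T] by apply: imset_f.
  by rewrite (disjointFl disjUW) // eq_uw imset_f.
pose e i : line_graph G := Sub [set u i; w i] (mem_edges _ _ _ (adj_uw i)).
have meet_e i j : val (e i) :&: val (e j) != set0 -> i = j.
  case/set0Pn => x /setIP[/set2P[]-> /set2P[]].
  - exact: inj_u.
  - by move/eqP; rewrite (negPf (neq_uw i j)).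
  - by move/esym/eqP; rewrite (negPf (neq_uw j i)).
  - exact: inj_w.
(* Equal edges meet, because an edge is nonempty, so [meet_e] applies to them. *)
have inj_e : injective e.
  move=> i j eq_e; apply: meet_e; rewrite eq_e setIid.
  by apply/set0Pn; exists (u j); apply: set21.
rewrite -cardsT -(card_imset _ inj_e); apply/leq_alpha/independentP.
move=> _ _ /imsetP[i _ ->] /imsetP[j _ ->]; apply/negP => /andP[neq_e].
by move/meet_e => eq_ij; rewrite eq_ij eqxx in neq_e.
Qed.

End Matching.

Theorem theorem2p12 (n : nat) (G : sgraph) :
  3 <= n -> is_sun n G ->
  alpha G + alpha (line_graph G) = 2 * n /\
  alpha G * alpha (line_graph G) = n ^ 2.
Proof.
move=> _ [_ cardG [u [w /= [[inj_u inj_w] [coverG disjUW] indU adjE]]]].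
(* The perfect matching is the case [j == i] of the sun's adjacency rule. *)
have adj_uw i : adj (u i) (w i) by rewrite adjE eqxx.
have -> : alpha G = n.
  apply/eqP; rewrite eqn_leq; apply/andP; split.
    by have := alpha_leq_matching _ _ _ _ adj_uw coverG; rewrite card_ord.
  by have := leq_alpha _ _ indU; rewrite card_imset // card_ord.
have -> : alpha (line_graph G) = n.
  apply/eqP; rewrite eqn_leq; apply/andP; split.
    by have := alpha_line_graph_leq G; rewrite cardG mul2n doubleK.
  rewrite -{1}(card_ord n).
  exact: (leq_alpha_line_graph_matching _ _ _ _ adj_uw).
by rewrite addnn mul2n mulnn.
Qed.
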